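(* Let $n\ge1$ and let $\mathcal{T}$ be an $n$-periodic triangulation of the strip $\mathcal{U}_n$ with $1\le r\le n$ bridging arcs, up to translates. Let $\mathcal{F}_n=(m_{ij})_{j-i\ge -2}$ be the $n$-arithmetic frieze associated to $\mathcal{T}$ with common differences $d_{ik}=m_{i,(i+k-3)+n}-m_{i,i+k-3}$ ($i\in\mathbb{Z}$, $k\in\{1,\dots,n\}$). Then $$d_{ik}=r\, n_{i-1}\, n_{i+k-2},$$ where $i-1$ and $i+k-2$ are reduced modulo $n$ (to representatives in $\{1,\dots,n\}$), and $(n_1,\dots,n_n)$ are the labels of the lower vertices of $\mathcal{U}_n$ obtained from $\mathcal{T}$ by the labeling algorithm with a starting vertex on the upper boundary.
   Context: Infinite friezes: an infinite frieze is an array $(m_{ij})_{i,j\in\mathbb{Z},\,j-i\ge -2}$ of integers with $m_{i,i-2}=0$, $m_{i,i-1}=1$ for all $i$, $m_{ij}>0$ for all $j\ge i$, and $m_{ij}m_{i+1,j+1}-m_{i+1,j}m_{i,j+1}=1$ for all $j-i\ge -1$. It is $n$-periodic if $m_{ij}=m_{i+n,j+n}$ for all $i\le j$; its quiddity sequence is then $(m_{11},\dots,m_{nn})$, which determines it. It is $n$-arithmetic if, with $d_{ik}=m_{i,(i+k-3)+n}-m_{i,i+k-3}$, one has $m_{i,(i+k-3)+(l+1)n}-m_{i,(i+k-3)+ln}=d_{ik}$ for all $l\ge0$, $i\in\mathbb{Z}$, $k\in\{1,\dots,n\}$; the $d_{ik}$ are the common differences. Strip: $\mathcal{U}_n$ is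 $\mathbb{R}\times$ (closed interval) with vertices $0^{(k)}$, $k\in\mathbb{Z}$, on the upper boundary and vertices $1^{(k)},\dots,n^{(k)}$, $k\in\mathbb{Z}$, on the lower boundary, ordered from left to right on the lower boundary by: $i^{(k)}\le j^{(l)}$ iff $k<l$, or $k=l$ and $i\le j$; the vertices $0^{(k)}$ are ordered from left to right by $k$, with $0^{(k)}$ above $1^{(k)},\dots,n^{(k)}$. An arc in $\mathcal{U}_n$ is (the isotopy class of) a non-self-intersecting curve connecting two vertices such that (A1) at least one vertex is on the lower boundary; (A2) the two vertices are neither equal nor neighbors; (A3) if one vertex is on the upper boundary, the superscripts of the two vertices are equal. Arcs $0^{(k)}j^{(k)}$ to the upper boundary are called bridging. A triangulation of $\mathcal{U}_n$ is a maximal collection of arcs that pairwise do not meet in the interior of $\mathcal{U}_n$; the regions into which it cuts $\mathcal{U}_n$ are called triangles. It is $n$-periodic if it has a fundamental domain: an $(n+3)$-gon $\mathcal{P}$ with vertices $0^{(k)},0^{(k+1)}$ and $i^{(k)},(i+1)^{(k)},\dots,n^{(k)},1^{(k+1)},\dots,i^{(k+1)}$ for some $i\in\{1,\dots,n\}$, $k\in\mathbb{Z}$, bounded on the sides by the arcs $0^{(k)}i^{(k)}$ and $0^{(k+1)}i^{(k+1)}$ of the triangulation, such that the triangulation is covered by the horizontal translates of $\mathcal{P}$ (shifting superscripts by integers); translates are taken with respect to these shifts, so $r$ is the number of $j\in\{1,\dots,n\}$ with $0^{(k)}j^{(k)}\in\mathcal{T}$ (for any fixed $k$). In an $n$-periodic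 triangulation each triangle is either bounded by three sides, or is a four-sided region with vertices $i^{(k)},i'^{(k+1)},0^{(k)},0^{(k+1)}$ having one side on the upper boundary (such a region also counts as a triangle). Associated frieze: the quiddity sequence of an $n$-periodic triangulation $\mathcal{T}$ is $(a_1,\dots,a_n)$, where $a_i$ is the number of triangles of $\mathcal{T}$ incident with $i^{(k)}$ (independent of $k$). The frieze associated to $\mathcal{T}$ is the $n$-periodic infinite frieze with $m_{ii}=a_i$ for $1\le i\le n$ (it exists and is $n$-arithmetic). Labels with starting vertex $v=0^{(k)}$ on the upper boundary: all vertices on the upper boundary always share one common label, so $n_v(w)=0$ for every upper vertex $w$. Set $n_v(w)=1$ for every lower vertex $w$ joined with $v$ by an arc of $\mathcal{T}$. All remaining lower vertices are labeled iteratively: in any triangle of $\mathcal{T}$, in which upper vertices $0^{(k')},0^{(k'+1)}$ (if both occur) are regarded as one single vertex, whenever two of the three vertices are labeled, the remaining vertex gets as label the sum of the two given labels. The label of $i^{(k')}$ then depends neither on $k'$ nor on $k$, and is denoted $n_i$, for $1\le i\le n$. *)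

(* Defs.v *)
From HB Require Import structures.
From mathcomp Require Import all_boot all_order all_algebra.
From mathcomp Require Import boolp classical_sets functions cardinality.

Set Implicit Arguments.
Unset Strict Implicit.
Unset Printing Implicit Defensive.

Import Order.TTheory GRing.Theory Num.Theory.
Local Open Scope classical_set_scope.
Local Open Scope ring_scope.

(* An array (m_ij) with j - i >= -2 is a total function int -> int -> int;
   its values at j - i < -2 are never used. *)
Record infinite_frieze (m : int -> int -> int) : Prop := InfiniteFrieze {
  frieze0 : forall i, m i (i - 2) = 0;
  frieze1 : forall i, m i (i - 1) = 1;
  frieze_gt0 : forall i j, i <= j -> 0 < m i j;
  frieze_rule : forall i j, -1 <= j - i ->
    m i j * m (i + 1) (j + 1) - m (i + 1) j * m i (j + 1) = 1 }.

Definition frieze_periodic (n : nat) (m : int -> int -> int) : Prop :=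
  forall i j, i <= j -> m i j = m (i + n%:Z) (j + n%:Z).

Definition common_diff (n : nat) (m : int -> int -> int) (i : int) (k : nat)
    : int :=
  m i ((i + k%:Z - 3) + n%:Z) - m i (i + k%:Z - 3).

Definition frieze_arithmetic (n : nat) (m : int -> int -> int) : Prop :=
  forall (l : nat) (i : int) (k : nat), (1 <= k <= n)%N ->
    m i ((i + k%:Z - 3) + (l.+1 * n)%N%:Z) - m i ((i + k%:Z - 3) + (l * n)%N%:Z)
    = common_diff n m i k.

(* [Up k] is 0^(k).  [Low p] is the p-th lower vertex from the left, where
   i^(k), for 1 <= i <= n, has position p = i + k n: the left-to-right order of
   the lower boundary is then the usual order of int. *)
Inductive vertex : Type := Up of int | Low of int.

Definition vertex_code (v : vertex) : int + int :=
  match v with Up k => inl k | Low p => inr p end.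
Definition vertex_decode (c : int + int) : vertex :=
  match c with inl k => Up k | inr p => Low p end.
Lemma vertex_codeK : cancel vertex_code vertex_decode.
Proof. by case. Qed.
HB.instance Definition _ := Equality.copy vertex (can_type vertex_codeK).

Definition is_upper (v : vertex) : bool := if v is Up _ then true else false.

Definition low (n : nat) (i : nat) (k : int) : vertex := Low (i%:Z + k * n%:Z).

Definition superscript (n : nat) (v : vertex) : int :=
  match v with Up k => k | Low p => ((p - 1) %/ n%:Z)%Z end.

Definition shift (n : nat) (l : int) (v : vertex) : vertex :=
  match v with Up k => Up (k + l) | Low p => Low (p + l * n%:Z) end.

Definition neighbors (u v : vertex) : bool :=
  match u, v with
  | Up k, Up l => `|k - l| == 1
  | Low p, Low q => `|p - q| == 1
  | _, _ => false
  end.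

(* The strip is simply connected, so the isotopy class of an arc is determined
   by its two endpoints. *)
Definition is_arc (n : nat) (u v : vertex) : bool :=
  [&& ~~ (is_upper u && is_upper v),
      u != v, ~~ neighbors u v &
      (is_upper u || is_upper v) ==> (superscript n u == superscript n v)].

(* Order in which the boundary vertices are met when the boundary of the strip
   is run through counterclockwise from the left end: the lower boundary from
   left to right, then the upper boundary from right to left. *)
Definition before (u v : vertex) : bool :=
  match u, v with
  | Low p, Low q => p < q
  | Low _, Up _ => true
  | Up _, Low _ => false
  | Up k, Up l => l < k
  end.

Definition between (x u v : vertex) : bool :=
  (before u x && before x v) || (before v x && before x u).

(* The arcs uv and xy necessarily meet in the interior iff their endpoints are
   four distinct vertices that alternate along the boundary. *)
Definition crossing (u v x y : vertex) : bool :=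
  [&& x \notin [:: u; v], y \notin [:: u; v] & between x u v (+) between y u v].

(* Collections of arcs are symmetric relations on the vertices. *)
Record noncrossing (n : nat) (T : vertex -> vertex -> Prop) : Prop :=
  Noncrossing {
  noncrossing_sym : forall u v, T u v -> T v u;
  noncrossing_arc : forall u v, T u v -> is_arc n u v;
  noncrossingP : forall u v x y, T u v -> T x y -> ~~ crossing u v x y }.

Definition triangulation (n : nat) (T : vertex -> vertex -> Prop) : Prop :=
  noncrossing n T /\
  forall S : vertex -> vertex -> Prop, noncrossing n S ->
    (forall u v, T u v -> S u v) -> forall u v, S u v -> T u v.

(* Vertices of the (n+3)-gon spanned by 0^(k), 0^(k+1), i^(k), ..., i^(k+1). *)
Definition in_domain (n i : nat) (k : int) (v : vertex) : bool :=
  match v with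
  | Up l => (l == k) || (l == k + 1)
  | Low p => i%:Z + k * n%:Z <= p <= i%:Z + (k + 1) * n%:Z
  end.

Definition fundamental_domain (n : nat) (T : vertex -> vertex -> Prop)
    (i : nat) (k : int) : Prop :=
  [/\ T (Up k) (low n i k), T (Up (k + 1)) (low n i (k + 1)) &
      forall u v, T u v <->
        exists u' v' l, [/\ T u' v', in_domain n i k u', in_domain n i k v',
                            u = shift n l u' & v = shift n l v']].

Definition periodic_triangulation (n : nat) (T : vertex -> vertex -> Prop)
    : Prop :=
  triangulation n T /\
  exists (i : nat) (k : int), (1 <= i <= n)%N /\ fundamental_domain n T i k.

Definition bridging_number (n : nat) (T : vertex -> vertex -> Prop) (k : int)
    : nat :=
  #|[set j : 'I_n | `[< T (Up k) (low n j.+1 k) >]]%SET|.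

Definition side (T : vertex -> vertex -> Prop) (u v : vertex) : Prop :=
  T u v \/ neighbors u v.

(* A triangle is given by its set of vertices.  Three pairwise joined vertices
   bound a region: all vertices lie on the boundary of the strip, so no arc of a
   noncrossing collection enters the region.  In the four-sided case, since
   an arc to the upper boundary joins vertices with equal superscripts, Low p is
   some i^(k), Low q is some i'^(k+1), and neither diagonal is an arc. *)
Variant triangle (T : vertex -> vertex -> Prop) : set vertex -> Prop :=
  | Triangle3 u v w of side T u v & side T v w & side T u w :
      triangle T [set u; v; w]
  | Triangle4 k p q of T (Up k) (Low p) & T (Up (k + 1)) (Low q)
                     & side T (Low p) (Low q) :
      triangle T [set Up k; Up (k + 1); Low p; Low q].

Definition triangles_at (T : vertex -> vertex -> Prop) (v : vertex)
    : set (set vertex) :=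
  [set t | triangle T t /\ t v].

Definition quiddity (n : nat) (T : vertex -> vertex -> Prop) (a : nat -> nat)
    : Prop :=
  forall (i : nat) (k : int), (1 <= i <= n)%N ->
    (triangles_at T (low n i k) #= `I_(a i))%card.

Definition associated_frieze (n : nat) (T : vertex -> vertex -> Prop)
    (m : int -> int -> int) : Prop :=
  [/\ infinite_frieze m, frieze_periodic n m &
      exists a : nat -> nat, quiddity n T a /\
        forall i : nat, (1 <= i <= n)%N -> m i%:Z i%:Z = (a i)%:Z].

(* Identifies the two upper vertices of a four-sided triangle. *)
Definition merge (v : vertex) : option int :=
  if v is Low p then Some p else None.

(* A state of the algorithm is a partial labeling of the vertices. *)
Definition init_labeling (T : vertex -> vertex -> Prop) (k : int) (w : vertex)
    : option nat :=
  match w with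
  | Up _ => Some 0%N
  | Low p => if `[< T (Up k) (Low p) >] then Some 1%N else None
  end.

Inductive labeling_state (T : vertex -> vertex -> Prop) (k : int)
    : (vertex -> option nat) -> Prop :=
  | LabelInit : labeling_state T k (init_labeling T k)
  | LabelStep s t u v w a b of labeling_state T k s & triangle T t
      & t u & t v & t w & uniq [:: merge u; merge v; merge w]
      & s u = Some a & s v = Some b & s w = None :
      labeling_state T k [eta s with w |-> Some (a + b)%N].

(* [w] receives the label [c] when the starting vertex is 0^(k).  There are
   infinitely many vertices, but each is labeled after finitely many steps. *)
Definition has_label (T : vertex -> vertex -> Prop) (k : int) (w : vertex)
    (c : nat) : Prop :=
  exists2 s, labeling_state T k s & s w = Some c.

Definition lower_labels (n : nat) (T : vertex -> vertex -> Prop) (k : int)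
    (lab : nat -> nat) : Prop :=
  forall (i : nat) (k' : int), (1 <= i <= n)%N ->
    has_label T k (low n i k') (lab i).

(* The representative of p modulo n in {1, ..., n}. *)
Definition residue (n : nat) (p : int) : nat := `|((p - 1) %% n%:Z)%Z|%N.+1.

(* Main.v *)
Require Import Defs.
From mathcomp Require Import all_boot all_order all_algebra.
From mathcomp Require Import finmap.
From mathcomp Require Import boolp classical_sets functions cardinality.
From mathcomp Require Import zify ring.

(** Attach to every lower vertex p a vector (L p, N p) of Z^2: to the s-th
    bridging vertex the vector (s, 1), and to the middle vertex of a triangle
    with three lower vertices the sum of the vectors of the two others.  Then N
    is the labeling, consecutive vectors have determinant 1, and going once
    around the fan of triangles at p shows that the vectors at p - 1 and p + 1
    sum to a_p times the vector at p, so that their determinant is a_p.  The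
    Pluecker relation for these determinants is the frieze rule, hence
    m_ij = L (j + 1) N (i - 1) - L (i - 1) N (j + 1).  A shift by n leaves N
    unchanged and adds r N to L, which gives the common differences. *)

Set Implicit Arguments.
Unset Strict Implicit.
Unset Printing Implicit Defensive.

Import Order.TTheory GRing.Theory Num.Theory.
Local Open Scope ring_scope.

(** * Additive functions on an abstract triangulated strip *)

(* [S p q] is only meaningful for [p < q]; [B] holds at the bridging vertices. *)
Record strip_sides (S : int -> int -> Prop) (B : int -> Prop) : Prop :=
  StripSides {
  sides_succ : forall p, S p (p + 1);
  sides_split : forall p q, p + 1 < q -> S p q ->
    exists x, [/\ p < x, x < q, S p x & S x q];
  sides_noncrossing : forall p q x y, S p q -> S x y ->
    p < x -> x < q -> q < y -> False;
  sides_bridge : forall p q b, S p q -> B b -> p < b -> b < q -> False;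
  bridge_side : forall p q, p < q -> B p -> B q ->
    (forall b, B b -> p < b -> b < q -> False) -> S p q;
  bridge_prev : forall y, exists b, [/\ B b, b < y &
    forall b', B b' -> b < b' -> b' < y -> False];
  bridge_next : forall y, exists b, [/\ B b, y < b &
    forall b', B b' -> y < b' -> b' < b -> False] }.

Definition lower_triangle (S : int -> int -> Prop) (x y z : int) : Prop :=
  [/\ x < y, y < z, S x y, S y z & S x z].

Definition triangle_additive (S : int -> int -> Prop) (f : int -> int) : Prop :=
  forall x y z, lower_triangle S x y z -> f y = f x + f z.

(** Below the side joining two consecutive bridging vertices lies a polygon. [sides_split] cuts it
    at the middle vertex of a triangle whose two ends are already covered, so [P] spreads downwards
    by induction on the length of the side. *)
Lemma lower_triangle_ind S B (hS : strip_sides S B) (P : int -> Prop) :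
  (forall b, B b -> P b) ->
  (forall x y z, lower_triangle S x y z -> P x -> P z -> P y) ->
  forall y, P y.
Proof.
move=> PB Ptri y.
have inner (d : nat) p q : q - p <= d%:Z -> p < q -> S p q -> P p -> P q ->
    forall y, p <= y -> y <= q -> P y.
  elim: d p q => [|d IH] p q led ltpq Spq Pp Pq {}y lepy leyq; first by lia.
  have [<- //|nepy] := eqVneq p y; have [-> //|neyq] := eqVneq y q.
  have [|x [ltpx ltxq Spx Sxq]] := sides_split hS _ Spq; first by lia.
  have Px : P x by apply: (Ptri p x q).
  have [leyx|ltxy] := leP y x.
    by apply: (IH p x) => //; lia.
  by apply: (IH x q) => //; lia.
have [By|nBy] := pselect (B y); first exact: PB.
have [b [Bb ltb nb]] := bridge_prev hS y.
have [c [Bc ltc nc]] := bridge_next hS y.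
apply: (inner `|c - b|%N b c) => //; try lia; try exact: PB.
apply: (bridge_side hS) => // [|x Bx ltbx ltxc]; first by lia.
have [ltxy|ltyx|eqxy] := ltgtP x y; last by rewrite eqxy in Bx.
- exact: nb ltxy.
- exact: nc ltxc.
Qed.

Lemma lower_triangle_exists S B (hS : strip_sides S B) y :
  ~ B y -> exists x z, lower_triangle S x y z.
Proof.
move: y; apply: (lower_triangle_ind hS) => // x y z xyz _ _ _.
by exists x, z.
Qed.

(** If the outer vertices differed, a short side of one triangle would cross the long side of the
    other. *)
Lemma lower_triangle_unique S B (hS : strip_sides S B) x y z x' z' :
  lower_triangle S x y z -> lower_triangle S x' y z' -> x = x' /\ z = z'.
Proof.
move=> [xy yz Sxy Syz Sxz] [x'y yz' Sx'y Syz' Sx'z'].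
have nc := sides_noncrossing hS.
split.
  have [h|h|//] := ltgtP x x'.
  - by case: (nc _ _ _ _ Sxy Sx'z').
  - by case: (nc _ _ _ _ Sx'y Sxz).
have [h|h|//] := ltgtP z z'.
- by case: (nc _ _ _ _ Sxz Syz').
- by case: (nc _ _ _ _ Sx'z' Syz).
Qed.

Lemma bridge_not_middle S B (hS : strip_sides S B) x y z :
  lower_triangle S x y z -> ~ B y.
Proof. by move=> [xy yz _ _ Sxz] By; apply: (sides_bridge hS Sxz By). Qed.

(** A relation, because the recursion from a middle vertex to the ends of its triangle is not
    structural on [int]. For strip sides it is total, and it is functional because a middle vertex
    determines its triangle and is never bridging. *)
Inductive value (S : int -> int -> Prop) (B : int -> Prop) (c : int -> int)
    : int -> int -> Prop :=
  | ValueBridge b of B b : value S B c b (c b)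
  | ValueSum x y z u v of lower_triangle S x y z & value S B c x u
      & value S B c z v : value S B c y (u + v).

Lemma value_functional S B (hS : strip_sides S B) c y u v :
  value S B c y u -> value S B c y v -> u = v.
Proof.
move=> yu; elim: yu v => {y u} [b Bb|x y z u w xyz _ IHx _ IHz] v yv.
  case: yv Bb => // x y z {}u {}v xyz _ _ By.
  by case: (bridge_not_middle hS xyz).
case: yv xyz IHx IHz => [b Bb xyz|x' {}y z' u' v' x'yz' x'u' z'v' xyz IHx IHz].
  by case: (bridge_not_middle hS xyz).
have [eqx eqz] := lower_triangle_unique hS xyz x'yz'; subst x' z'.
by rewrite (IHx _ x'u') (IHz _ z'v').
Qed.

Lemma value_additive S B (hS : strip_sides S B) c f :
  (forall y, value S B c y (f y)) ->
  triangle_additive S f /\ (forall b, B b -> f b = c b).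
Proof.
move=> fP; split=> [x y z xyz|b Bb].
  apply: (value_functional hS (fP y)); exact: ValueSum xyz _ _.
by apply: (value_functional hS (fP b)); exact: ValueBridge.
Qed.

Lemma additive_extension S B (hS : strip_sides S B) (c : int -> int) :
  exists f, triangle_additive S f /\ (forall b, B b -> f b = c b).
Proof.
have /choice[f fP] : forall y, exists u, value S B c y u.
  apply: (lower_triangle_ind hS) => [b Bb|x y z xyz [u xu] [v zv]].
    by exists (c b); exact: ValueBridge.
  by exists (u + v); exact: ValueSum xyz _ _.
by exists f; exact: value_additive fP.
Qed.

Lemma additive_eq S B (hS : strip_sides S B) f g :
  triangle_additive S f -> triangle_additive S g ->
  (forall b, B b -> f b = g b) -> f =1 g.
Proof.
move=> fS gS fg; apply: (lower_triangle_ind hS) => // x y z xyz fgx fgz.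
by rewrite (fS _ _ _ xyz) (gS _ _ _ xyz) fgx fgz.
Qed.

(** * Vectors at the lower vertices and their determinants *)

Definition bridge_step (B : int -> Prop) (f : int -> int) (d : int) : Prop :=
  forall b b', B b -> B b' -> b < b' ->
    (forall x, B x -> b < x -> x < b' -> False) -> f b' = f b + d.

(** The determinant of [(L q, N q)] and [(L p, N p)], taken in the order that yields 1 rather than
    -1 on consecutive vertices. *)
Definition vdet (L N : int -> int) (p q : int) : int := L q * N p - L p * N q.

(** Between consecutive bridging vertices the determinant is the step of [L]. Splitting a side at
    [y] preserves the value 1 on both parts, as the vector at [y] is the sum of the vectors at the
    ends; repeated splitting leads down to the side from [p] to [p + 1]. *)
Lemma vdet_succ S B (hS : strip_sides S B) (L N : int -> int) :
  triangle_additive S L -> triangle_additive S N -> (forall b, B b -> N b = 1) ->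
  bridge_step B L 1 -> forall p, vdet L N p (p + 1) = 1.
Proof.
move=> aL aN N1 L1 p.
have inner (d : nat) x z : z - x <= d%:Z -> x < z -> S x z -> vdet L N x z = 1 ->
    x <= p -> p < z -> vdet L N p (p + 1) = 1.
  elim: d x z => [|d IH] x z led ltxz Sxz xz1 lexp ltpz; first by lia.
  have [ltxz1|lezx1] := ltP (x + 1) z; last first.
    have -> : p = x by lia.
    by rewrite -xz1; congr vdet; lia.
  have [y [xy yz Sxy Syz]] := sides_split hS ltxz1 Sxz.
  have xyz : lower_triangle S x y z by [].
  have Ly := aL _ _ _ xyz; have Ny := aN _ _ _ xyz.
  have [ltpy|leyp] := ltP p y.
    by apply: (IH x y) => //; try lia; rewrite -xz1 /vdet Ly Ny; ring.
  by apply: (IH y z) => //; try lia; rewrite -xz1 /vdet Ly Ny; ring.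
(* Searching before [p + 1] and after [p] gives [b <= p < c], even if [p] or [p + 1] is itself
   bridging. *)
have [b [Bb ltb nb]] := bridge_prev hS (p + 1).
have [c [Bc ltc nc]] := bridge_next hS p.
have ltbc : b < c by lia.
have noB x : B x -> b < x -> x < c -> False.
  move=> Bx ltbx ltxc; have [ltxp|lepx] := ltP x (p + 1); first exact: nb ltxp.
  by apply: nc ltxc => //; lia.
apply: (inner `|c - b|%N b c) => //; try lia.
- exact: (bridge_side hS).
- by rewrite /vdet (L1 b c) // !N1 //; ring.
Qed.

(** * Fans of triangles below a side *)

(* [phi] is [Low] for the fan to the right of p, and [Low \o -%R] for the
   mirror image of the fan to the left. *)
Lemma fan (S : int -> int -> Prop) (phi : int -> vertex)
  (split_S : forall p q, p + 1 < q -> S p q ->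
    exists x, [/\ p < x, x < q, S p x & S x q])
  (nc_S : forall p q x y, S p q -> S x y -> p < x -> x < q -> q < y -> False)
  (phi_inj : injective phi) p q :
  p < q -> S p q ->
  exists ts : seq (set vertex), [/\ uniq ts,
    forall t, t \in ts <-> exists x y, [/\ lower_triangle S p x y, y <= q &
                                       t = [set phi p; phi x; phi y]%classic] &
    forall f, triangle_additive S f -> f (p + 1) = f q + (size ts)%:Z * f p].
Proof.
have [d] := ubnP `|q - p|%N; elim: d q => // d IH q led ltpq Spq.
have [ltpq1|leqp1] := ltP (p + 1) q; last first.
  have -> : q = p + 1 by lia.
  exists [::]; split=> // [t|f _]; last by rewrite mul0r addr0.
  split=> // -[x [y [[px xy _ _ _] yq _]]]; lia.
(* The triangle [p], [z], [q] is the topmost of the fan; the others lie below the side from [p] to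
   [z]. *)
have [z [ltpz ltzq Spz Szq]] := split_S _ _ ltpq1 Spq.
have [|ts [uts tsP tsf]] := IH z _ ltpz Spz; first by lia.
exists ([set phi p; phi z; phi q]%classic :: ts); split=> [|t|f af].
- rewrite /= uts andbT; apply/negP => /tsP[x [y [[px xy _ _ _] yz E]]].
  have : [set phi p; phi x; phi y]%classic (phi q) by rewrite -E; right.
  by move=> [[]|] /= /phi_inj; lia.
- rewrite in_cons; split.
    move=> /orP[/eqP->|/tsP[x [y [pxy yz ->]]]].
      by exists z, q; split.
    by exists x, y; split=> //; lia.
  move=> [x [y [[px xy Spx Sxy Spy] yq ->]]].
  (* A triangle reaching beyond [z] must be the topmost one: otherwise one of its sides would cross
     a side of [p], [z], [q]. *)
  have [lezy|ltyz] := leP y z.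
    by apply/orP; right; apply/tsP; exists x, y; split.
  have eyq : y = q.
    have [ltyq|//|//] := ltgtP y q; last by lia.
    by case: (nc_S _ _ _ _ Spy Szq).
  subst y.
  have -> : x = z.
    have [ltxz|ltzx|//] := ltgtP x z.
    - by case: (nc_S _ _ _ _ Spz Sxy).
    - by case: (nc_S _ _ _ _ Spx Szq).
  by rewrite eqxx.
- rewrite (tsf f af) (af p z q) //= -addn1 PoszD; ring.
Qed.

(** * Crossings, arcs and maximality *)

Lemma eq_Up k l : (Up k == Up l) = (k == l). Proof. by []. Qed.
Lemma eq_Low p q : (Low p == Low q) = (p == q). Proof. by []. Qed.
Lemma eq_UpLow k p : (Up k == Low p) = false. Proof. by []. Qed.
Lemma eq_LowUp k p : (Low p == Up k) = false. Proof. by []. Qed.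
Definition eq_vertexE := (eq_Up, eq_Low, eq_UpLow, eq_LowUp).

Lemma crossingC u v x y : crossing u v x y = crossing x y u v.
Proof.
rewrite /crossing !inE /between /before.
case: u => u; case: v => v; case: x => x; case: y => y;
  rewrite !eq_vertexE /= ?andbF ?orbF ?andbT //=; lia.
Qed.

Lemma crossing_swap u v x y : crossing v u x y = crossing u v x y.
Proof.
rewrite /crossing !inE /between orbC; congr [&& _, _ & _].
  by rewrite orbC.
by rewrite orbC; congr addb; rewrite orbC.
Qed.

Lemma crossing_same u v x : crossing u v u x = false.
Proof. by rewrite /crossing !inE eqxx. Qed.

Lemma is_arcC n u v : is_arc n u v = is_arc n v u.
Proof.
rewrite /is_arc andbC [u == v]eq_sym [superscript n u == _]eq_sym.
rewrite [is_upper u || _]orbC [is_upper u && _]andbC.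
suff -> : neighbors u v = neighbors v u by rewrite -!andbA; do !bool_congr.
by case: u => u; case: v => v //=; rewrite distrC.
Qed.

(** Adding the arc in both orientations keeps the collection noncrossing, and a triangulation is
    maximal. *)
Lemma triangulation_mem n T u v : triangulation n T -> is_arc n u v ->
  (forall x y, T x y -> ~~ crossing u v x y) -> T u v.
Proof.
move=> [[Tsym Tarc Tnc] Tmax] uv nuv.
pose S x y := [\/ T x y, (x = u /\ y = v) | (x = v /\ y = u)].
apply: (Tmax S) => [|x y Txy|]; [|by constructor 1|by constructor 2].
split=> [x y [/Tsym|[-> ->]|[-> ->]]|x y [/Tarc|[-> ->]|[-> ->]]|].
- by constructor 1.
- by constructor 3.
- by constructor 2.
- by [].
- by [].
- by rewrite is_arcC.
have nvu x y : T x y -> ~~ crossing v u x y by rewrite crossing_swap; exact: nuv.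
move=> x y x' y' [Txy|[-> ->]|[-> ->]] [Tx'y'|[-> ->]|[-> ->]].
- exact: Tnc.
- by rewrite crossingC; apply: nuv.
- by rewrite crossingC; apply: nvu.
- exact: nuv.
- by rewrite crossing_same.
- by rewrite crossing_swap crossing_same.
- exact: nvu.
- by rewrite crossing_swap crossing_same.
- by rewrite crossing_same.
Qed.

(** * Lower sides and bridging arcs of a periodic triangulation *)

Lemma superscriptD n (p l : int) : (1 <= n)%N ->
  superscript n (Low (p + l * n%:Z)) = superscript n (Low p) + l.
Proof.
move=> n1; have n0 : n%:Z != 0 by lia.
by rewrite /superscript addrAC [X in (X %/ _)%Z = _]addrC divzMDl ?n0 //; exact: addrC.
Qed.

(** Arcs to the upper boundary join equal superscripts, so no other upper vertex can be joined to
    [Low p]. *)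
Definition bridging n (T : vertex -> vertex -> Prop) (p : int) : Prop :=
  T (Up (superscript n (Low p))) (Low p).

Definition low_side (T : vertex -> vertex -> Prop) (p q : int) : Prop :=
  side T (Low p) (Low q).

Lemma side_sym n T u v : noncrossing n T -> side T u v -> side T v u.
Proof.
move=> [Tsym _ _] [/Tsym|uv]; [by left|right].
by case: u uv => u; case: v => v //=; rewrite distrC.
Qed.

Lemma side_UpLow n T k p : noncrossing n T ->
  side T (Up k) (Low p) -> k = superscript n (Low p) /\ bridging n T p.
Proof.
move=> [_ Tarc _] [Tkp|//]; have /and4P[_ _ _ /eqP kE] := Tarc _ _ Tkp.
by rewrite /bridging -kE.
Qed.

Lemma side_UpUp n T k l : noncrossing n T -> side T (Up k) (Up l) -> `|k - l| = 1.
Proof. by move=> [_ Tarc _] [/Tarc /and4P[]|/eqP]. Qed.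

Lemma side_irrefl n T u : noncrossing n T -> ~ side T u u.
Proof.
move=> [_ Tarc _] [/Tarc /and4P[_]|]; first by rewrite eqxx.
by case: u => u /=; rewrite subrr normr0.
Qed.

Lemma triangulation_shift n T l u v : periodic_triangulation n T ->
  T u v -> T (shift n l u) (shift n l v).
Proof.
move=> [_ [i [k [_ [_ _ TP]]]]] /TP[u' [v' [l' [Tu'v' u'in v'in -> ->]]]].
apply/TP; exists u', v', (l' + l); split=> //.
- by case: u' {Tu'v' u'in} => x /=; congr (_ _); ring.
- by case: v' {Tu'v' v'in} => x /=; congr (_ _); ring.
Qed.

Lemma bridgingD n T (p l : int) : (1 <= n)%N -> periodic_triangulation n T ->
  bridging n T p -> bridging n T (p + l * n%:Z).
Proof.
move=> n1 Tper /(triangulation_shift l Tper).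
by rewrite /bridging superscriptD.
Qed.

Lemma low_sideD n T (p q l : int) : periodic_triangulation n T ->
  low_side T p q -> low_side T (p + l * n%:Z) (q + l * n%:Z).
Proof.
move=> Tper [/(triangulation_shift l Tper)|pq]; [by left|right].
by move: pq => /=; rewrite opprD addrACA subrr addr0.
Qed.

Lemma low_side_noncrossing n T p q x y : noncrossing n T ->
  low_side T p q -> low_side T x y -> p < x -> x < q -> q < y -> False.
Proof.
move=> [_ _ Tnc] [Tpq|/=]; last by lia.
move=> [Txy|/=]; last by lia.
move=> px xq qy; have := Tnc _ _ _ _ Tpq Txy.
rewrite /crossing /between /before !inE !eq_vertexE; lia.
Qed.

Lemma low_side_bridge n T p q b : noncrossing n T ->
  low_side T p q -> bridging n T b -> p < b -> b < q -> False.
Proof.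
move=> [_ _ Tnc] [Tpq|/=]; last by lia.
move=> Tb pb bq; have := Tnc _ _ _ _ Tpq Tb.
rewrite /crossing /between /before !inE !eq_vertexE; lia.
Qed.

(** An arc crossing this one has an end strictly between [p] and [q] and its other end left of [p],
    right of [q] or on the upper boundary. The three hypotheses exclude these cases, and maximality
    supplies the arc. *)
Lemma low_side_mem n T (p q : int) : triangulation n T -> p < q ->
  (forall u v, low_side T u v -> u < p -> p < v -> v < q -> False) ->
  (forall u v, low_side T u v -> p < u -> u < q -> q < v -> False) ->
  (forall b, bridging n T b -> p < b -> b < q -> False) -> low_side T p q.
Proof.
move=> Ttri pq left_ right_ up_; have [Tnc _] := Ttri.
have [qE|nqE] := eqVneq q (p + 1); first by right; rewrite qE /=; lia.
left; apply: triangulation_mem Ttri _ _.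
  by apply/and4P; split=> //; rewrite ?eq_vertexE /=; lia.
have bad x y : T (Low x) (Low y) -> x < y -> ~~ crossing (Low p) (Low q) (Low x) (Low y).
  move=> Txy xy; apply/negP; rewrite /crossing /between /before !inE !eq_vertexE => h.
  have [xp|px] := ltP x p.
    by apply: (left_ x y (or_introl Txy)); lia.
  by apply: (right_ x y (or_introl Txy)); lia.
have badU x y : T (Up x) (Low y) -> ~~ crossing (Low p) (Low q) (Up x) (Low y).
  move=> Txy; apply/negP; rewrite /crossing /between /before !inE !eq_vertexE => h.
  have [_ By] := side_UpLow Tnc (or_introl Txy).
  by apply: (up_ y) => //; lia.
have swapxy u v x y : crossing u v x y = crossing u v y x.
  by rewrite crossingC crossing_swap crossingC.
have [Tsym Tarc _] := Tnc.
case=> x [] y Txy.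
- by have /and4P[] := Tarc _ _ Txy.
- exact: badU.
- by rewrite swapxy; apply: badU; apply: Tsym.
- have [xy|yx|xy] := ltgtP x y; first exact: bad.
    by rewrite swapxy; apply: bad => //; apply: Tsym.
  by have /and4P[_] := Tarc _ _ Txy; rewrite xy eqxx.
Qed.

Lemma ex_max_int (P : int -> Prop) (a b : int) : a <= b -> P a ->
  exists x, [/\ P x, a <= x, x <= b & forall y, P y -> x < y -> y <= b -> False].
Proof.
move=> ab Pa.
have exP : exists i, `[< P (a + i%:Z) >] && (i <= `|b - a|)%N.
  by exists 0%N; rewrite addr0 andbT; apply/asboolP.
have ubP i : `[< P (a + i%:Z) >] && (i <= `|b - a|)%N -> (i <= `|b - a|)%N.
  by case/andP.
case: (ex_maxnP exP ubP) => i /andP[/asboolP Pi lei] maxi.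
exists (a + i%:Z); split=> //; try lia.
move=> y Py lty leyb; have := maxi `|y - a|%N.
have yE : y = a + `|y - a|%N%:Z by lia.
rewrite -yE asboolT //=; lia.
Qed.

Lemma ex_min_int (P : int -> Prop) (a b : int) : a <= b -> P b ->
  exists x, [/\ P x, a <= x, x <= b & forall y, P y -> y < x -> a <= y -> False].
Proof.
move=> ab Pb; have [||x [Px bx xa minx]] := @ex_max_int (fun x => P (- x)) (- b) (- a).
- by lia.
- by rewrite opprK.
exists (- x); split=> //; try lia.
by move=> y Py yx ay; apply: (minx (- y)); rewrite ?opprK //; lia.
Qed.

(** The fundamental domain is bounded by a bridging arc, whose translates go arbitrarily far in both
    directions. *)
Lemma bridging_unbounded n T (p : int) : (1 <= n)%N -> periodic_triangulation n T ->
  exists b c, [/\ bridging n T b, bridging n T c, b < p & p < c].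
Proof.
move=> n1 Tper; have [[Tnc _] [i [k [_ [T1 _ _]]]]] := Tper.
have [_ Bik] := side_UpLow Tnc (or_introl T1).
move: (_ + _) Bik => c Bc.
have [m lem] : exists m : nat, `|p - c| < m%:Z * n%:Z by exists `|p - c|%N.+1; nia.
exists (c - m%:Z * n%:Z), (c + m%:Z * n%:Z).
split; [rewrite -mulNr| |lia|lia]; exact: bridgingD.
Qed.

(** Maximality yields the two existence properties of sides, periodicity yields the bridging
    vertices before and after any position. *)
Lemma strip_sides_of_triangulation n T : (1 <= n)%N ->
  periodic_triangulation n T -> strip_sides (low_side T) (bridging n T).
Proof.
move=> n1 Tper; have [Ttri _] := Tper; have [Tnc _] := Ttri.
split.
- by move=> p; right => /=; lia.
- move=> p q pq Spq.
  (* The apex below [p q] is the last vertex before [q] joined to [p]; the neighbor [p + 1] is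
     always a candidate. *)
  have [||x [[Spx px] p1x xq maxx]] :=
    @ex_max_int (fun x => low_side T p x /\ p < x) (p + 1) (q - 1).
  + by lia.
  + by split; [right => /=; lia|lia].
  exists x; split=> //; first by lia.
  (* As x is maximal, an arc crossing xq would also cross px or pq. *)
  apply: (low_side_mem Ttri) => [|u v Suv ux xv vq|u v Suv xu uq qv|b Bb xb bq].
  + by lia.
  + have [up|pu|up] := ltgtP u p.
    * by apply: (low_side_noncrossing Tnc Suv Spq) => //; lia.
    * by apply: (low_side_noncrossing Tnc Spx Suv).
    * by subst u; apply: (maxx v) => //; [split => //|]; lia.
  + by apply: (low_side_noncrossing Tnc Spq Suv) => //; lia.
  + by apply: (low_side_bridge Tnc Spq Bb) => //; lia.
- by move=> p q x y; exact: (low_side_noncrossing Tnc).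
- by move=> p q b; exact: (low_side_bridge Tnc).
- move=> p q pq Bp Bq noB; apply: (low_side_mem Ttri) => // u v Suv up pv vq.
  + exact: (low_side_bridge Tnc Suv Bp).
  + exact: (low_side_bridge Tnc Suv Bq).
- move=> y; have [b [_ [Bb _ ltby _]]] := bridging_unbounded y n1 Tper.
  have [|x [Bx bx xy maxx]] := @ex_max_int (bridging n T) b (y - 1) _ Bb; first by lia.
  by exists x; split=> //; [lia|move=> b' /maxx h xb' b'y; apply: h; lia].
- move=> y; have [_ [c [_ Bc _ ltyc]]] := bridging_unbounded y n1 Tper.
  have [|x [Bx yx xc minx]] := @ex_min_int (bridging n T) (y + 1) c _ Bc; first by lia.
  by exists x; split=> //; [lia|move=> b' /minx h yb' b'x; apply: h; lia].
Qed.

(** * Triangles incident with a lower vertex *)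

Local Open Scope classical_set_scope.

Lemma card_seq_set (U : choiceType) (A : set U) (s : seq U) :
  uniq s -> (forall x, A x <-> x \in s) -> (A #= `I_(size s))%card.
Proof.
move=> us sP; have -> : A = [set` [fset x in s]%fset].
  by apply/seteqP; split=> x; rewrite /= inE /=; [move/sP|move=> ?; apply/sP].
by apply/card_eq_fsetP; rewrite card_fseq undup_id.
Qed.

Lemma set3P (U : Type) (a b c x : U) :
  [set a; b; c] x <-> [\/ x = a, x = b | x = c].
Proof.
split=> [[[]|] ->|[] ->].
- by constructor 1.
- by constructor 2.
- by constructor 3.
- by left; left.
- by left; right.
- by right.
Qed.

Lemma set3_rev (U : Type) (a b c : U) : [set a; b; c] = [set c; b; a].
Proof. by rewrite [LHS]setUC [X in _ `|` X]setUC setUA. Qed.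

(** The region above a side with bridging ends; it is four-sided when the ends are joined to
    different upper vertices. *)
Definition upper_triangle (n : nat) (x y : int) : set vertex :=
  let k := superscript n (Low x) in let l := superscript n (Low y) in
  if k == l then [set Up k; Low x; Low y] else [set Up k; Up l; Low x; Low y].

Lemma superscript_le n (p q : int) : p <= q ->
  superscript n (Low p) <= superscript n (Low q).
Proof. by move=> pq; apply: lez_pdiv2r => //; rewrite lerD2r. Qed.

(** A side longer than [n] would pass over the bridging vertex [x + n], so the superscript grows by
    at most 1. *)
Lemma bridging_superscript n T (x y : int) : (1 <= n)%N ->
  periodic_triangulation n T -> x < y -> bridging n T x -> low_side T x y ->
  superscript n (Low x) != superscript n (Low y) ->
  superscript n (Low y) = superscript n (Low x) + 1.
Proof.
move=> n1 Tper xy Bx Sxy ne; have [[Tnc _] _] := Tper.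
have le1 := superscript_le n (ltW xy).
have yx : y <= x + 1 * n%:Z.
  rewrite leNgt; apply/negP => xny.
  by apply: (low_side_bridge Tnc Sxy (bridgingD 1 n1 Tper Bx)); lia.
by have := superscript_le n yx; rewrite superscriptD //; move: ne le1; lia.
Qed.

(** Puts the vertices of a triangle in order. Two upper vertices never occur in a three-sided
    triangle: a lower vertex is joined to at most one upper vertex, and three integers cannot be
    pairwise at distance 1. *)
Lemma triangleE n T (t : set vertex) : (1 <= n)%N -> periodic_triangulation n T ->
  triangle T t <->
  (exists x y z, lower_triangle (low_side T) x y z /\ t = [set Low x; Low y; Low z])
  \/ (exists x y, [/\ x < y, bridging n T x, bridging n T y, low_side T x y &
                     t = upper_triangle n x y]).
Proof.
move=> n1 Tper; have [[Tnc _] _] := Tper.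
have sym u v := @side_sym n T u v Tnc.
have irr u := @side_irrefl n T u Tnc.
have upP k x y : side T (Up k) (Low x) -> side T (Up k) (Low y) ->
    side T (Low x) (Low y) ->
    exists x' y', [/\ x' < y', bridging n T x', bridging n T y', low_side T x' y' &
       [set Up k; Low x; Low y] = upper_triangle n x' y'].
  move=> /(side_UpLow Tnc)[kx Bx] /(side_UpLow Tnc)[ky By] Sxy.
  have [xy|yx|xy] := ltgtP x y.
  - by exists x, y; rewrite /upper_triangle -kx -ky eqxx.
  - exists y, x; rewrite /upper_triangle -kx -ky eqxx; split=> //; first exact: sym.
    by rewrite setUAC.
  - by case: (irr (Low x)); rewrite {2}xy.
split.
- case=> {t} [u v w uv vw uw|k p q Tp Tq Spq].
    have vu := sym _ _ uv; have wv := sym _ _ vw; have wu := sym _ _ uw.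
    case: u v w uv vw uw vu wv wu => u [] v [] w uv vw uw vu wv wu.
    + move: (side_UpUp Tnc uv) (side_UpUp Tnc uw) (side_UpUp Tnc vw); lia.
    + have [uE _] := side_UpLow Tnc uw; have [vE _] := side_UpLow Tnc vw.
      by case: (irr (Up u)); rewrite {2}uE -vE.
    + have [uE _] := side_UpLow Tnc uv; have [wE _] := side_UpLow Tnc wv.
      by case: (irr (Up u)); rewrite {2}uE -wE.
    + by right; exact: upP.
    + have [vE _] := side_UpLow Tnc vu; have [wE _] := side_UpLow Tnc wu.
      by case: (irr (Up v)); rewrite {2}vE -wE.
    + right; have -> : [set Low u; Up v; Low w] = [set Up v; Low u; Low w].
        by rewrite [[set Low u] `|` _]setUC.
      exact: upP.
    + right; have -> : [set Low u; Low v; Up w] = [set Up w; Low u; Low v].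
        by rewrite setUC setUA.
      exact: upP.
    + left.
      have neq x y : side T (Low x) (Low y) -> x <> y.
        by move=> Sxy xy; apply: (irr (Low x)); rewrite {2}xy.
      case: (ltgtP u v) (neq _ _ uv) => // luv _;
      case: (ltgtP v w) (neq _ _ vw) => // lvw _;
      case: (ltgtP u w) (neq _ _ uw) => // luw _; try lia.
      * by exists u, v, w.
      * exists u, w, v; split=> //; by rewrite [LHS]setUAC.
      * exists w, u, v; split=> //; by rewrite [LHS]setUC setUA.
      * exists v, u, w; split=> //; by rewrite [[set Low u] `|` _]setUC.
      * exists v, w, u; split=> //; by rewrite -[LHS]setUA setUC.
      * exists w, v, u; split=> //; exact: set3_rev.
  have [pk Bp] := side_UpLow Tnc (or_introl Tp).
  have [qk Bq] := side_UpLow Tnc (or_introl Tq).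
  right; exists p, q; split=> //.
  + by rewrite ltNge; apply/negP => /(superscript_le n); rewrite -pk -qk; lia.
  + by rewrite /upper_triangle -pk -qk ifN //; lia.
- case=> [[x [y [z [[_ _ xy yz xz] ->]]]]|[x [y [xy Bx By Sxy ->]]]].
    exact: Triangle3.
  rewrite /upper_triangle; case: eqP => [kl|/eqP ne].
    by apply: Triangle3 => //; left=> //; rewrite kl.
  have E := bridging_superscript n1 Tper xy Bx Sxy ne.
  by rewrite E; apply: Triangle4 => //; rewrite -E.
Qed.

Lemma fan_right S B (hS : strip_sides S B) p q : p < q -> S p q ->
  exists ts : seq (set vertex), [/\ uniq ts,
    forall t, t \in ts <-> exists x y, [/\ lower_triangle S p x y, y <= q &
                                       t = [set Low p; Low x; Low y]] &
    forall f, triangle_additive S f -> f (p + 1) = f q + (size ts)%:Z * f p].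
Proof.
apply: fan; [exact: (sides_split hS)|exact: (sides_noncrossing hS)|].
by move=> x y [].
Qed.

Lemma fan_left S B (hS : strip_sides S B) p q : q < p -> S q p ->
  exists ts : seq (set vertex), [/\ uniq ts,
    forall t, t \in ts <-> exists x y, [/\ lower_triangle S x y p, q <= x &
                                       t = [set Low x; Low y; Low p]] &
    forall f, triangle_additive S f -> f (p - 1) = f q + (size ts)%:Z * f p].
Proof.
move=> qp Sqp.
(* Negation reverses the order, so swapping the arguments of [S] keeps the smaller vertex first. *)
have [|||||ts [uts tsP tsf]] :=
  @fan (fun x y => S (- y) (- x)) (fun x => Low (- x)) _ _ _ (- p) (- q).
- move=> x y xy Sxy; have [|z [yz zx Syz Szx]] := sides_split hS _ Sxy; first lia.
  by exists (- z); rewrite opprK; split=> //; lia.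
- move=> x y u v Sxy Suv xu uy yv.
  by apply: (sides_noncrossing hS Suv Sxy); lia.
- by move=> x y [] /oppr_inj.
- by lia.
- by rewrite !opprK.
exists ts; split=> // [t|f af].
  rewrite tsP; split=> -[x [y [[]]]].
    rewrite !opprK => px xy Spx Sxy Spy yq ->.
    exists (- y), (- x); split; [by split=> //; lia|lia|].
    exact: set3_rev.
  move=> xy yp Sxy Syp Sxp qx ->; exists (- y), (- x); rewrite !opprK.
  split; [by split; rewrite ?opprK //; lia|lia|].
  exact: set3_rev.
have := tsf (f \o -%R); rewrite /= !opprK opprD opprK => -> //.
move=> x y z [xy yz Sxy Syz Sxz] /=; rewrite addrC; apply: af.
by split=> //; lia.
Qed.

Lemma upper_triangle_low n x y p : upper_triangle n x y (Low p) <-> p = x \/ p = y.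
Proof.
rewrite /upper_triangle; case: ifP => _; split.
- by move=> [[|[]]|[]]; [by []|left|right].
- by move=> [] ->; [left; right|right].
- by move=> [[[|]|[]]|[]]; [by []|by []|left|right].
- by move=> [] ->; [left; right|right].
Qed.

Lemma upper_triangle_up n x y : exists k, upper_triangle n x y (Up k).
Proof.
exists (superscript n (Low x)); rewrite /upper_triangle.
by case: ifP => _; [left; left|left; left; left].
Qed.

(** The triangles at [p] are the one with middle vertex [p], the fan below its left side and the fan
    below its right side. The fans reduce [f (p - 1) + f (p + 1)] to [f x + f z], which is one more
    [f p]. *)
Lemma triangles_at_nonbridge n T p : (1 <= n)%N -> periodic_triangulation n T ->
  ~ bridging n T p ->
  exists t : nat, (triangles_at T (Low p) #= `I_t)%card /\
    forall f, triangle_additive (low_side T) f -> f (p - 1) + f (p + 1) = t%:Z * f p.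
Proof.
move=> n1 Tper nBp; have hS := strip_sides_of_triangulation n1 Tper.
have [x [z xpz]] := lower_triangle_exists hS nBp.
have [xp pz Sxp Spz Sxz] := xpz.
have [rs [urs rsP rsf]] := fan_right hS pz Spz.
have [ls [uls lsP lsf]] := fan_left hS xp Sxp.
pose t0 := [set Low x; Low p; Low z].
exists (size (t0 :: ls ++ rs)); split; last first.
  move=> f af; rewrite (rsf f af) (lsf f af) /= size_cat (af _ _ _ xpz).
  by rewrite -addn1 !PoszD; ring.
apply: card_seq_set => [|t].
  rewrite /= mem_cat negb_or cat_uniq uls urs /= andbT -!andbA.
  apply/and3P; split.
  - apply/negP => /lsP[u [v [[uv vp _ _ _] _ E]]].
    have : [set Low u; Low v; Low p] (Low z) by rewrite -E; right.
    by move=> /set3P[] []; lia.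
  - apply/negP => /rsP[u [v [[pu uv _ _ _] _ E]]].
    have : [set Low p; Low u; Low v] (Low x) by rewrite -E; left; left.
    by move=> /set3P[] []; lia.
  - apply/hasPn => t /rsP[u [v [[pu uv _ _ _] _ ->]]]; apply/negP.
    move=> /lsP[u' [v' [[u'v' v'p _ _ _] _ E]]].
    have : [set Low u'; Low v'; Low p] (Low u) by rewrite -E; left; right.
    by move=> /set3P[] []; lia.
rewrite in_cons mem_cat; split.
  move=> [/(triangleE _ n1 Tper)[[u [v [w [uvw ->]]]]|[u [v [_ Bu Bv _ ->]]]]]; last first.
    by move=> /upper_triangle_low[] E; subst p.
  have [uv vw Suv Svw Suw] := uvw.
  move=> /set3P[] [E]; subst.
  (* A triangle reaching beyond [z] would have a side crossing the one from [x] to [z]. *)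
  - apply/orP; right; apply/orP; right; apply/rsP.
    exists v, w; split=> //; rewrite leNgt; apply/negP => zw.
    exact: (sides_noncrossing hS Sxz Suw).
  - have [-> ->] := lower_triangle_unique hS uvw xpz.
    by rewrite eqxx.
  - apply/orP; right; apply/orP; left; apply/lsP.
    exists u, v; split=> //; rewrite leNgt; apply/negP => ux.
    exact: (sides_noncrossing hS Suw Sxz).
move=> /orP[/eqP->|/orP[/lsP|/rsP]].
- by split; [apply/(triangleE _ n1 Tper); left; exists x, p, z|left; right].
- move=> [u [v [uvp _ ->]]]; split; last by right.
  by apply/(triangleE _ n1 Tper); left; exists u, v, p.
- move=> [u [v [puv _ ->]]]; split; last by left; left.
  by apply/(triangleE _ n1 Tper); left; exists p, u, v.
Qed.

(** The two fans now end at the neighboring bridging vertices [x] and [z], and two upper triangles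
    join them. They account for [f x + f z = 2 f p], because [f] changes by [d] from each bridging
    vertex to the next. *)
Lemma triangles_at_bridge n T p : (1 <= n)%N -> periodic_triangulation n T ->
  bridging n T p ->
  exists t : nat, (triangles_at T (Low p) #= `I_t)%card /\
    forall f d, triangle_additive (low_side T) f -> bridge_step (bridging n T) f d ->
      f (p - 1) + f (p + 1) = t%:Z * f p.
Proof.
move=> n1 Tper Bp; have hS := strip_sides_of_triangulation n1 Tper.
have [x [Bx xp nox]] := bridge_prev hS p.
have [z [Bz pz noz]] := bridge_next hS p.
have Sxp := bridge_side hS xp Bx Bp nox.
have Spz := bridge_side hS pz Bp Bz noz.
have [rs [urs rsP rsf]] := fan_right hS pz Spz.
have [ls [uls lsP lsf]] := fan_left hS xp Sxp.
pose tl := upper_triangle n x p; pose tr := upper_triangle n p z.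
have noup u v a b c : upper_triangle n u v <> [set Low a; Low b; Low c].
  by move=> E; have [k] := upper_triangle_up n u v; rewrite E => /set3P[].
exists (size [:: tl, tr & ls ++ rs]); split; last first.
  move=> f d af fd; rewrite (rsf f af) (lsf f af) /= size_cat.
  rewrite (fd _ _ Bp Bz pz noz) (fd _ _ Bx Bp xp nox).
  by rewrite -addn2 !PoszD; ring.
apply: card_seq_set => [|t].
  rewrite !cons_uniq in_cons !mem_cat !negb_or cat_uniq uls urs andbT -!andbA.
  have nls u v : upper_triangle n u v \notin ls.
    by apply/negP => /lsP[a [b [_ _ /noup]]].
  have nrs u v : upper_triangle n u v \notin rs.
    by apply/negP => /rsP[a [b [_ _ /noup]]].
  rewrite !nls !nrs !andTb; apply/andP; split.
    (* The two upper triangles differ, as [x] is a vertex of [tl] only. *)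
    case: pselect => // E; have : tr (Low x) by rewrite -E; apply/upper_triangle_low; left.
    by move=> /upper_triangle_low; lia.
  apply/hasPn => t /rsP[u [v [[pu uv _ _ _] _ ->]]]; apply/negP.
  move=> /lsP[u' [v' [[u'v' v'p _ _ _] _ E]]].
  have : [set Low u'; Low v'; Low p] (Low u) by rewrite -E; left; right.
  by move=> /set3P[] []; lia.
rewrite !in_cons mem_cat; split.
  move=> [/(triangleE _ n1 Tper)[[u [v [w [uvw ->]]]]|[u [v [uv Bu Bv Suv ->]]]]]; last first.
    move=> /upper_triangle_low[] E; subst.
      have -> : v = z.
        have [vz|zv|//] := ltgtP v z; first by case: (noz v).
        by case: (sides_bridge hS Suv Bz).
      by rewrite eqxx orbT.
    have -> : u = x.
      have [ux|xu|//] := ltgtP u x; last by case: (nox u).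
      by case: (sides_bridge hS Suv Bx).
    by rewrite eqxx.
  have [uv vw Suv Svw Suw] := uvw.
  move=> /set3P[] [E]; subst.
  - apply/or4P; constructor 4; apply/rsP.
    exists v, w; split=> //; rewrite leNgt; apply/negP => zw.
    exact: (sides_bridge hS Suw Bz).
  - by case: (bridge_not_middle hS uvw).
  - apply/or4P; constructor 3; apply/lsP.
    exists u, v; split=> //; rewrite leNgt; apply/negP => ux.
    exact: (sides_bridge hS Suw Bx).
move=> /or4P[/eqP->|/eqP->|/lsP|/rsP].
- split; last by apply/upper_triangle_low; right.
  by apply/(triangleE _ n1 Tper); right; exists x, p.
- split; last by apply/upper_triangle_low; left.
  by apply/(triangleE _ n1 Tper); right; exists p, z.
- move=> [u [v [uvp _ ->]]]; split; last by right.
  by apply/(triangleE _ n1 Tper); left; exists u, v, p.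
- move=> [u [v [puv _ ->]]]; split; last by left; left.
  by apply/(triangleE _ n1 Tper); left; exists p, u, v.
Qed.

Lemma triangles_at_card n T p t : (1 <= n)%N -> periodic_triangulation n T ->
  (triangles_at T (Low p) #= `I_t)%card ->
  forall f d, triangle_additive (low_side T) f -> bridge_step (bridging n T) f d ->
    f (p - 1) + f (p + 1) = t%:Z * f p.
Proof.
move=> n1 Tper pt f d af fd.
have uniq_card t' : (triangles_at T (Low p) #= `I_t')%card -> t = t'.
  by move=> pt'; apply/card_eq_II; apply: card_eq_trans pt'; rewrite card_eq_sym.
have [Bp|nBp] := pselect (bridging n T p).
  have [t' [/uniq_card-> h]] := triangles_at_bridge n1 Tper Bp.
  exact: h fd.
by have [t' [/uniq_card-> h]] := triangles_at_nonbridge n1 Tper nBp; exact: h.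
Qed.

(** * Correctness of the labeling algorithm *)

Lemma upper_triangle_vertex n x y v : upper_triangle n x y v ->
  [\/ is_upper v, v = Low x | v = Low y].
Proof.
case: v => [k|p]; first by constructor 1.
by move=> /upper_triangle_low[] ->; [constructor 2|constructor 3].
Qed.

(* The last invariant guarantees that a step in a triangle with three lower
   vertices always labels the middle one. *)
Lemma labeling_state_value n T k s : (1 <= n)%N -> periodic_triangulation n T ->
  labeling_state T k s ->
  [/\ forall v, is_upper v -> s v = Some 0%N,
      forall p a, s (Low p) = Some a ->
        value (low_side T) (bridging n T) (fun=> 1) p a%:Z &
      forall x y z, lower_triangle (low_side T) x y z ->
        s (Low y) -> s (Low x) /\ s (Low z)].
Proof.
move=> n1 Tper; have hS := strip_sides_of_triangulation n1 Tper.
have [[Tnc _] _] := Tper.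
elim=> {s} [|s t u v w a b _ [sup slow smid] Tt tu tv tw uvw su sv sw].
  split=> [[]//|p a /=|x y z xyz /=].
    case: asboolP => // Tkp [<-]; apply: ValueBridge.
    by have [] := side_UpLow Tnc (or_introl Tkp).
  case: asboolP => // Tky _; case: (bridge_not_middle hS xyz).
  by have [] := side_UpLow Tnc (or_introl Tky).
case: w tw uvw sw => [k'|p] tw uvw sw; first by rewrite sup in sw.
have [val_p mid_p] : value (low_side T) (bridging n T) (fun=> 1) p (a + b)%N%:Z /\
    forall x z, lower_triangle (low_side T) x p z -> s (Low x) /\ s (Low z).
  have val1 c q : bridging n T q -> s (Low q) = Some c -> c = 1%N.
    by move=> Bq /slow /(value_functional hS)/(_ (ValueBridge _ _ Bq)) [].
  move: uvw; rewrite /= !inE negb_or andbT => /andP[/andP[uv up] vp].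
  have [[x [y [z [xyz tE]]]]|[x [y [xy Bx By Sxy tE]]]] := (triangleE t n1 Tper).1 Tt;
    subst t.
    have midE : s (Low y) -> (p == x) || (p == z) -> False.
      by move=> /(smid _ _ _ xyz)[sx sz] /orP[]/eqP E; rewrite E in sw; rewrite sw in sx sz.
    (* If [p] were an end, the middle vertex would already be labeled, and by the invariant so would
       [p]. *)
    have py : p = y.
      case/set3P: tw => [] [pE] //; subst p; exfalso; case/set3P: tu; case/set3P: tv => vE uE;
        subst; rewrite ?eqxx // in uv up vp; apply: midE; rewrite ?eqxx ?orbT ?su ?sv //.
    subst p.
    suff [u' [v' [su' sv' ->]]] : exists u' v', [/\ s (Low x) = Some u', s (Low z) = Some v' &
        (a + b = u' + v')%N].
      split; first by rewrite PoszD; apply: ValueSum xyz (slow _ _ su') (slow _ _ sv').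
      move=> x' z' /(lower_triangle_unique hS xyz)[<- <-].
      by rewrite su' sv'.
    case/set3P: tu => uE; case/set3P: tv => vE; subst; rewrite ?eqxx // in uv up vp.
      by exists a, b.
    by exists b, a; rewrite addnC.
  (* In an upper triangle [merge] forces one of [u], [v] to be upper with label 0 and the other to
     be bridging with label 1, so [p] gets 1. *)
  have Bp : bridging n T p by move: tw => /upper_triangle_low[] ->.
  split; last by move=> x' z' /(bridge_not_middle hS).
  suff -> : (a + b)%N = 1%N by exact: ValueBridge.
  have pxy := (upper_triangle_low n x y p).1 tw.
  have upE v' c : is_upper v' -> s v' = Some c -> c = 0%N.
    by move=> /sup ->; case.
  have upM v' : is_upper v' -> Defs.merge v' = None by case: v'.
  case: (upper_triangle_vertex tu) => uE; case: (upper_triangle_vertex tv) => vE.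
  - by rewrite (upM u) // (upM v) // in uv.
  - by subst v; rewrite (upE _ _ uE su) (val1 _ _ Bx sv).
  - by subst v; rewrite (upE _ _ uE su) (val1 _ _ By sv).
  - by subst u; rewrite (upE _ _ vE sv) (val1 _ _ Bx su).
  - by subst u v; rewrite eqxx in uv.
  - by subst u v; case: pxy => E; subst p; rewrite ?eqxx in up vp.
  - by subst u; rewrite (upE _ _ vE sv) (val1 _ _ By su).
  - by subst u v; case: pxy => E; subst p; rewrite ?eqxx in up vp.
  - by subst u v; rewrite eqxx in uv.
split=> [v' v'up /=|q c /=|x y z xyz /=].
- by case: v' v'up => // k' _; rewrite eq_UpLow; exact: sup.
- rewrite eq_Low; case: eqP => [-> [<-]//|_]; exact: slow.
- rewrite !eq_Low => sy.
  have [sx sz] : s (Low x) /\ s (Low z).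
    move: sy; case: eqP => [yp _|_ sy]; last exact: smid sy.
    by apply: mid_p; rewrite -yp.
  by split; case: ifP.
Qed.

Local Close Scope classical_set_scope.

(** * Numbering the bridging vertices *)

Lemma int_antidifference (g : int -> int) :
  exists c : int -> int, forall p, c (p + 1) = c p + g p.
Proof.
exists (fun p => match p with
                 | Posz k => \sum_(j < k) g j%:Z
                 (* [Negz k] is [-(k + 1)]: the values of [g] from [-1] down to [-(k + 1)] are
                    subtracted. *)
                 | Negz k => - \sum_(j < k.+1) g (Negz j)
                 end).
case=> [k|[|k]].
- by rewrite -PoszD addn1 big_ord_recr.
- by rewrite /= big_ord0 big_ord1 addNr.
- have -> : Negz k.+1 + 1 = Negz k by lia.
  by rewrite [in RHS]big_ord_recr /= opprD addrNK.
Qed.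

Lemma antidifference_sum (c g : int -> int) (cg : forall p, c (p + 1) = c p + g p)
  p (k : nat) : c (p + k%:Z) = c p + \sum_(j < k) g (p + j%:Z).
Proof.
elim: k => [|k IH]; first by rewrite big_ord0 !addr0.
by rewrite big_ord_recr /= addrA -IH -cg -addrA -PoszD addn1.
Qed.

Lemma int_constant (h : int -> int) : (forall p, h (p + 1) = h p) ->
  forall p q, h p = h q.
Proof.
move=> hS.
have up p (k : nat) : h (p + k%:Z) = h p.
  elim: k => [|k IH]; first by rewrite addr0.
  by rewrite -addn1 PoszD addrA hS.
move=> p q; have [pq|qp] := leP p q.
  by rewrite -(up p `|q - p|%N); congr h; lia.
by rewrite -(up q `|p - q|%N); congr h; lia.
Qed.

(** Summing the indicator of the bridging vertices numbers them consecutively. Over a period the sum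
    grows by the number of bridging vertices in the window. *)
Lemma bridge_counter n T k0 : (1 <= n)%N -> periodic_triangulation n T ->
  exists c : int -> int, bridge_step (bridging n T) c 1 /\
    forall p, c (p + n%:Z) = c p + (bridging_number n T k0)%:Z.
Proof.
move=> n1 Tper; pose g p : int := `[< bridging n T p >]%:Z.
have [c cg] := int_antidifference g; exists c.
split=> [b b' Bb Bb' ltbb' nob|p].
  have [l b'E] : exists l : nat, b' = b + l.+1%:Z by exists `|(b' - b - 1)%R|%N; lia.
  subst b'.
  rewrite (antidifference_sum cg) big_ord_recl /= addr0 big1 ?addr0.
    by congr (_ + _); rewrite /g asboolT.
  move=> j _; have := ltn_ord j; rewrite /bump /= => ltjl.
  by rewrite /g asboolF // => /nob; apply; lia.
have gn q : g (q + n%:Z) = g q.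
  rewrite /g; congr (nat_of_bool _)%:Z; apply/asboolP/asboolP => B.
    by have := bridgingD (- 1) n1 Tper B; rewrite mulN1r addrK.
  by have := bridgingD 1 n1 Tper B; rewrite mul1r.
have /int_constant h q : c (q + 1 + n%:Z) - c (q + 1) = c (q + n%:Z) - c q.
  by rewrite addrAC !cg gn; ring.
rewrite -[LHS](subrK (c p)) [LHS]addrC; congr (_ + _).
(* The growth over [n] positions is the same everywhere, so it is computed on the window of
   superscript [k0], which starts at [1 + k0 n]. *)
rewrite (h p (1 + k0 * n%:Z)) (antidifference_sum cg) addrC addKr.
rewrite /bridging_number -sum1_card (big_morph Posz PoszD (erefl _)).
rewrite [RHS]big_mkcond /=; apply: eq_bigr => j _.
have jE : 1 + k0 * n%:Z + j%:Z = j.+1%:Z + k0 * n%:Z by lia.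
rewrite inE /g /bridging jE /low.
have -> : superscript n (Low (j.+1%:Z + k0 * n%:Z)) = k0.
  rewrite superscriptD //= -addn1 PoszD addrK divz_small ?add0r //.
  by have := ltn_ord j; lia.
by case: asboolP.
Qed.

Lemma low_residue n p : (1 <= n)%N ->
  low n (residue n p) (superscript n (Low p)) = Low p /\ (1 <= residue n p <= n)%N.
Proof.
move=> n1; have n0 : n%:Z != 0 by lia.
have := modz_ge0 (p - 1) n0; have := ltz_mod (p - 1) n0.
have := divz_eq (p - 1) n%:Z; rewrite /low /residue /superscript.
move: (_ %/ _)%Z (_ %% _)%Z => q r E r1 r2; split; last lia.
by congr Low; lia.
Qed.

(** * Frieze entries as determinants *)

Lemma frieze_periodicZ n m (l : int) i j : frieze_periodic n m -> i <= j ->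
  m i j = m (i + l * n%:Z) (j + l * n%:Z).
Proof.
move=> mper ij.
have := @int_constant (fun l => m (i + l * n%:Z) (j + l * n%:Z)) _ 0 l.
rewrite !mul0r !addr0; apply=> p.
by rewrite mulrDl mul1r !addrA -mper // lerD2r.
Qed.

(** The rows of zeros, of ones and of the quiddity agree. Each further row follows from the two
    before it by the frieze rule, which the determinants also satisfy, since positivity allows
    division by [m (i + 1) j]. *)
Lemma frieze_vdet m (L N : int -> int) : infinite_frieze m ->
  (forall p, vdet L N p (p + 1) = 1) ->
  (forall p, m p p = vdet L N (p - 1) (p + 1)) ->
  forall i j : int, i - 2 <= j -> m i j = vdet L N (i - 1) (j + 1).
Proof.
move=> [m0 m1 mgt0 mrule] LN1 mpp.
suff main (d : nat) : forall e : nat, (e <= d)%N -> forall i,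
    m i (i - 2 + e%:Z) = vdet L N (i - 1) (i - 1 + e%:Z).
  move=> i j ij; have -> : j = i - 2 + `|(j - (i - 2))%R|%N%:Z by lia.
  by rewrite (main _ _ (leqnn _)); congr vdet; lia.
elim: d => [|d IH] e led i.
  have -> : e = 0%N by lia.
  by rewrite !addr0 m0 /vdet; ring.
have [/IH//|] := leqP e d; move=> lde; have {led lde} -> : e = d.+1 by lia.
case: d IH => [|[|d]] IH.
- have -> : i - 2 + 1 = i - 1 by ring.
  by rewrite m1 LN1.
- have -> : i - 2 + 2%:Z = i by ring.
  by rewrite mpp; congr vdet; ring.
pose q := i + d.+1%:Z; pose j := i - 2 + d.+2%:Z.
have mE i' (l : nat) p p' p'' : (l <= d.+2)%N -> p = i' - 2 + l%:Z ->
    p' = i' - 1 -> p'' = i' - 1 + l%:Z -> m i' p = vdet L N p' p''.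
  by move=> lel -> -> ->; exact: IH.
have E1 : m i j = vdet L N (i - 1) q by apply: (mE i d.+2); rewrite // /j /q; lia.
have E2 : m (i + 1) (j + 1) = vdet L N i (q + 1).
  by apply: (mE (i + 1) d.+2); rewrite // /j /q; lia.
have E3 : m (i + 1) j = vdet L N i q.
  by apply: (mE (i + 1) d.+1); rewrite // /j /q; lia.
(* For [j = i] this entry lies in the row of ones, which [frieze_gt0] does not cover. *)
have gt0 : 0 < m (i + 1) j.
  rewrite /j; case: (d) => [|l]; last by apply: mgt0; lia.
  have -> : i - 2 + 2%:Z = i + 1 - 1 by lia.
  by rewrite m1.
have := mrule i j; rewrite E1 E2 E3 => rule.
have -> : i - 2 + d.+3%:Z = j + 1 by rewrite /j; lia.
have -> : i - 1 + d.+3%:Z = q + 1 by rewrite /q; lia.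
have plucker : vdet L N (i - 1) q * vdet L N i (q + 1)
    - vdet L N i q * vdet L N (i - 1) (q + 1) = 1.
  transitivity (vdet L N (i - 1) i * vdet L N q (q + 1)); first by rewrite /vdet; ring.
  by have := LN1 (i - 1); rewrite subrK LN1 => ->.
have /mulfI : vdet L N i q != 0 by rewrite -E3 gt_eqF.
apply; apply: oppr_inj; apply: (addrI (vdet L N (i - 1) q * vdet L N i (q + 1))).
by rewrite plucker rule // /j; lia.
Qed.

(** * From labels and quiddity to the common differences *)

Lemma lower_label_additive n T v lab : (1 <= n)%N -> periodic_triangulation n T ->
  lower_labels n T v lab ->
  triangle_additive (low_side T) (fun p => (lab (residue n p))%:Z) /\
  (forall b, bridging n T b -> (lab (residue n b))%:Z = 1).
Proof.
move=> n1 Tper labP; have hS := strip_sides_of_triangulation n1 Tper.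
apply: (value_additive hS) => p; have [pE rp] := low_residue p n1.
have [s sT] := labP _ (superscript n (Low p)) rp; rewrite pE => sp.
by have [_ + _] := labeling_state_value n1 Tper sT; exact.
Qed.

Lemma triangles_at_vdet n T p t (L N : int -> int) (dL dN : int) : (1 <= n)%N ->
  periodic_triangulation n T -> (triangles_at T (Low p) #= `I_t)%card ->
  triangle_additive (low_side T) L -> triangle_additive (low_side T) N ->
  bridge_step (bridging n T) L dL -> bridge_step (bridging n T) N dN ->
  (forall q, vdet L N q (q + 1) = 1) -> t%:Z = vdet L N (p - 1) (p + 1).
Proof.
move=> n1 Tper pt aL aN sL sN LN1.
have hL := triangles_at_card n1 Tper pt aL sL.
have hN := triangles_at_card n1 Tper pt aN sN.
transitivity (t%:Z * vdet L N (p - 1) p).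
  by have := LN1 (p - 1); rewrite subrK => ->; rewrite mulr1.
(* Adding the vanishing determinant of the vector at [p - 1] with itself brings in the sums of the
   vectors at [p - 1] and [p + 1]. *)
rewrite [RHS](_ : _ =
  (L (p - 1) + L (p + 1)) * N (p - 1) - L (p - 1) * (N (p - 1) + N (p + 1))).
  by rewrite hL hN /vdet; ring.
by rewrite /vdet; ring.
Qed.

Theorem proposition5p4 (n : nat) (n_ge1 : (1 <= n)%N)
    (T : vertex -> vertex -> Prop) (T_per : periodic_triangulation n T)
    (r : nat) (k0 : int) (r_def : r = bridging_number n T k0)
    (r_bounds : (1 <= r <= n)%N)
    (m : int -> int -> int) (m_assoc : associated_frieze n T m)
    (m_arith : frieze_arithmetic n m)
    (v : int) (lab : nat -> nat) (lab_def : lower_labels n T v lab) :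
  forall (i : int) (k : nat), (1 <= k <= n)%N ->
    common_diff n m i k =
      (r * lab (residue n (i - 1)) * lab (residue n (i + k%:Z - 2)))%N%:Z.
Proof.
have hS := strip_sides_of_triangulation n_ge1 T_per.
pose N p := (lab (residue n p))%:Z.
have [aN N1] : triangle_additive (low_side T) N /\
    (forall b, bridging n T b -> N b = 1) := lower_label_additive n_ge1 T_per lab_def.
have [c [c1 cn]] := bridge_counter k0 n_ge1 T_per.
(* [L] extends the numbering of the bridging vertices, where [N] is 1, so these carry the vectors
   [(s, 1)]. *)
have [L [aL Lc]] := additive_extension hS c.
have N0 : bridge_step (bridging n T) N 0 by move=> b b' Bb Bb' _ _; rewrite !N1 ?addr0.
have L1 : bridge_step (bridging n T) L 1.
  by move=> b b' Bb Bb' bb' nob; rewrite !Lc //; exact: c1.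
have [mfr mper [a [aP am]]] := m_assoc.
have LN1 := vdet_succ hS aL aN N1 L1.
have mpp p : m p p = vdet L N (p - 1) (p + 1).
  have [pE rp] := low_residue p n_ge1.
  have := aP _ (superscript n (Low p)) rp; rewrite pE => pa.
  rewrite -(triangles_at_vdet n_ge1 T_per pa aL aN L1 N0 LN1) -am //.
  rewrite [RHS](frieze_periodicZ (superscript n (Low p)) mper) //.
  by case: pE; rewrite /= => ->.
have tri_shift x y z : lower_triangle (low_side T) x y z ->
    lower_triangle (low_side T) (x + n%:Z) (y + n%:Z) (z + n%:Z).
  move=> [xy yz Sxy Syz Sxz].
  have Sn p q : low_side T p q -> low_side T (p + n%:Z) (q + n%:Z).
    by move=> /(low_sideD 1 T_per); rewrite !mul1r.
  by split; rewrite ?ltrD2r //; exact: Sn.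
have Bn b : bridging n T b -> bridging n T (b + n%:Z).
  by move=> /(bridgingD 1 n_ge1 T_per); rewrite mul1r.
(* Translates of additive functions are additive, so here and for [L] it suffices to compare values
   at bridging vertices. *)
have Nn p : N (p + n%:Z) = N p.
  apply: (additive_eq hS (f := fun p => N (p + n%:Z)) _ aN) => [x y z /tri_shift/aN //|b Bb].
  by rewrite !N1 //; exact: Bn.
have Ln p : L (p + n%:Z) = L p + r%:Z * N p.
  apply: (additive_eq hS (f := fun p => L (p + n%:Z)) (g := fun p => L p + r%:Z * N p))
    => [x y z /tri_shift/aL //|x y z xyz|b Bb].
    by rewrite (aL _ _ _ xyz) (aN _ _ _ xyz); ring.
  by rewrite !Lc ?N1 ?mulr1 ?cn ?r_def //; exact: Bn.
move=> i k /andP[k1 _]; rewrite /common_diff.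
rewrite !(frieze_vdet mfr LN1 mpp) //; try lia.
have -> : i + k%:Z - 3 + n%:Z + 1 = i + k%:Z - 2 + n%:Z by ring.
have -> : i + k%:Z - 3 + 1 = i + k%:Z - 2 by ring.
(* The terms with [L] cancel, and [r] times the two labels remains. *)
by rewrite /vdet Ln Nn !PoszM -/(N _) -/(N _); ring.
Qed.
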